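(* Let $X$ be a nonempty set and let $(X,\mu)$ be a pre-uniform space. Then the pre-topological space $(X,\tau(\mu))$, where $\tau(\mu)$ is the pre-topology induced by $\mu$, is a ($T_1$) regular pre-topological space.
   Context: A pre-topology on a set $Z$ is a family $\mathscr{T}\subseteq 2^{Z}$ with $\bigcup\mathscr{T}=Z$ that is closed under arbitrary unions (including the empty union, so $\emptyset\in\mathscr{T}$); finite intersections of members need not belong to it. Members of $\mathscr{T}$ are called open and complements of open sets are called closed. A pre-topological space $Z$ is $T_1$ if for any $y\neq z$ in $Z$ there are open $V,W$ with $V\cap\{y,z\}=\{y\}$ and $W\cap\{y,z\}=\{z\}$. It is regular if it is $T_1$ and for every $z\in Z$ and every closed $A\subseteq Z$ with $z\notin A$ there are open sets $V,O$ with $V\cap O=\emptyset$, $z\in V$, $A\subseteq O$. For a nonempty set $X$ put $\triangle=\{(x,x):x\in X\}$; for $A,B\subseteq X\times X$ and $x\in X$ put $A^{-1}=\{(y,x):(x,y)\in A\}$, $A\circ B=\{(x,y): \exists z\in X,\ (x,z)\in A \text{ and } (z,y)\in B\}$, $A[x]=\{y\in X:(x,y)\in A\}$. A pre-uniform structure (pre-uniformity) on $X$ is a nonempty family $\mu$ of nonempty subsets of $X\times X$ such that: (U1) $\triangle\subseteq U$ for all $U\in\mu$; (U2) $U\in\mu$ implies $U^{-1}\in\mu$; (U3) for each $U\in\mu$ there are $V,W\in\mu$ with $V\circ W\subseteq U$; (U4) if $U\in\mu$ and $U\subseteq V\subseteq X\times X$ then $V\in\mu$; (U5) $\bigcap\mu=\triangle$.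 Then $(X,\mu)$ is called a pre-uniform space. (Closure under finite intersections is not required.) The induced pre-topology is $\tau(\mu)=\{G\subseteq X:\text{for each }x\in G\text{ there is }U\in\mu\text{ with }U[x]\subseteq G\}$. *)

(* Defs.v *)
From mathcomp Require Import all_boot.
From mathcomp Require Import boolp classical_sets.

Set Implicit Arguments.
Unset Strict Implicit.
Unset Printing Implicit Defensive.

Local Open Scope classical_set_scope.

(* A family of subsets is represented by its predicate [set (set Z)]. Finite
   intersections of open sets are not required to be open, so the topologicalType
   hierarchy of MathComp-Analysis does not apply. *)
Record is_pretopology (Z : Type) (T : set (set Z)) : Prop := {
  pretop_cover : \bigcup_(A in T) A = [set: Z];
  pretop_bigcup : forall F : set (set Z), F `<=` T -> T (\bigcup_(A in F) A)
}.

Definition pretop_closed (Z : Type) (T : set (set Z)) (A : set Z) : Prop :=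
  T (~` A).

Definition pretop_T1 (Z : Type) (T : set (set Z)) : Prop :=
  forall y z : Z, y <> z ->
    exists V W : set Z, [/\ T V, T W,
      V `&` [set y; z] = [set y] & W `&` [set y; z] = [set z]].

Definition pretop_regular (Z : Type) (T : set (set Z)) : Prop :=
  pretop_T1 T /\
  forall (z : Z) (A : set Z), pretop_closed T A -> ~ A z ->
    exists V O : set Z, [/\ T V, T O, V `&` O = set0, V z & A `<=` O].

(* The library's [(W \; V)%relation] is read from right to left: it holds at
   (x, y) when V (x, z) and W (z, y) for some z. It is thus the composition
   V o W = {(x, y) | exists z, (x, z) in V and (z, y) in W}. *)
Record is_preuniformity (X : Type) (mu : set (set (X * X))) : Prop := {
  preunif_nonempty : mu !=set0;
  preunif_mem_nonempty : forall U, mu U -> U !=set0;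
  preunif_diagonal : forall U, mu U -> diagonal `<=` U;
  preunif_inv : forall U, mu U -> mu (U^-1)%relation;
  preunif_comp : forall U, mu U ->
    exists V W, [/\ mu V, mu W & (W \; V)%relation `<=` U];
  preunif_up : forall U V, mu U -> U `<=` V -> mu V;
  preunif_bigcap : \bigcap_(U in mu) U = diagonal
}.

(* [xsection U x] is the set U[x] of all y such that (x, y) is in U. *)
Definition preunif_pretop (X : Type) (mu : set (set (X * X))) : set (set X) :=
  [set G | forall x, G x -> exists2 U, mu U & xsection U x `<=` G].

(* Main.v *)
Require Import Defs.
From mathcomp Require Import all_boot.
From mathcomp Require Import boolp classical_sets.

Local Open Scope classical_set_scope.

(** The sections [U[x]] need not be open, but their interiors are: this is what
    axiom (U3) provides ([preunif_interior_open]). Open sets with prescribed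
    points are therefore produced as interiors of unions of sections.

    For [T1], if [y <> z] then (U5) gives [U] omitting [(y, z)], and the interior
    of [U[y]] contains [y] but not [z].

    For regularity, let [U[z]] miss the closed set [A] and pick [V], [W] with
    [V o W] included in [U]. Then [V[z]] is disjoint from the union of the sets
    [W^-1[a]] for [a] in [A], since a common point [y] would give
    [(z, y)] in [V] and [(y, a)] in [W], whence [a] in [U[z]]. The interiors of
    these two sets contain [z] and [A] respectively, and separate them. *)

Definition preunif_interior (X : Type) (mu : set (set (X * X))) (B : set X) :
    set X :=
  [set x | exists2 U, mu U & xsection U x `<=` B].

Lemma preunif_interior_sub (X : Type) (mu : set (set (X * X))) (B : set X) :
  is_preuniformity mu -> preunif_interior X mu B `<=` B.
Proof.
move=> hmu x [U muU]; apply; rewrite /xsection /= in_setE.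
exact: (preunif_diagonal hmu muU).
Qed.

(** If [U[x]] lies in [B] and [V o W] in [U], then [W[y]] lies in [B] for every
    [y] in [V[x]]: the section [V[x]] consists of interior points of [B]. *)
Lemma preunif_interior_open (X : Type) (mu : set (set (X * X))) (B : set X) :
  is_preuniformity mu -> preunif_pretop mu (preunif_interior X mu B).
Proof.
move=> hmu x [U muU UB].
have [V [W [muV muW VWU]]] := preunif_comp hmu muU.
exists V => // y; rewrite /xsection /= in_setE => Vxy.
exists W => // t; rewrite /xsection /= in_setE => Wyt.
by apply: UB; rewrite /xsection /= in_setE; apply: VWU; exists y.
Qed.

Lemma preunif_pretop_pretopology (X : Type) (mu : set (set (X * X))) :
  is_preuniformity mu -> is_pretopology (preunif_pretop mu).
Proof.
move=> hmu; split.
- rewrite -subTset => x _; exists setT => // t _.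
  by have [U muU] := preunif_nonempty hmu; exists U.
- move=> F FT x [A FA Ax].
  have [U muU UA] := FT A FA x Ax.
  by exists U => // t /UA At; exists A.
Qed.

(** Since the entourages intersect in the diagonal, some [U] omits [(y, z)]; the
    open set is the interior of [U[y]]. Exchanging the points gives [T1]. *)
Lemma preunif_pretop_open_avoiding {X : Type} {mu : set (set (X * X))} {y z : X} :
  is_preuniformity mu -> y <> z ->
  exists V, [/\ preunif_pretop mu V, V y & ~ V z].
Proof.
move=> hmu yz.
have [U muU nUyz] : exists2 U, mu U & ~ U (y, z).
  apply: contrapT => noU; apply: yz.
  have : (\bigcap_(U in mu) U) (y, z).
    by move=> U muU; apply: contrapT => nU; apply: noU; exists U.
  by rewrite (preunif_bigcap hmu).
exists (preunif_interior X mu (xsection U y)); split.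
- exact: preunif_interior_open.
- by exists U.
- by move=> /(preunif_interior_sub _ _ _ hmu); rewrite /xsection /= in_setE.
Qed.

Lemma preunif_pretop_T1 (X : Type) (mu : set (set (X * X))) :
  is_preuniformity mu -> pretop_T1 (preunif_pretop mu).
Proof.
move=> hmu y z yz.
have [V [oV Vy nVz]] := preunif_pretop_open_avoiding hmu yz.
have [W [oW Wz nWy]] := preunif_pretop_open_avoiding hmu (nesym yz).
exists V, W; split=> //; apply/seteqP; split=> t /=.
- by case=> Vt [//|tz]; rewrite tz in Vt.
- by move=> ->; split; [|left].
- by case=> Wt [ty|//]; rewrite ty in Wt.
- by move=> ->; split; [|right].
Qed.

(** Shrinking both sides at once with [V o W] included in [U] does the job: a
    point common to [V[z]] and to [W^-1[a]] would be a midpoint putting [a] in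
    [U[z]], which misses [A]. *)
Lemma preunif_pretop_separation (X : Type) (mu : set (set (X * X)))
    (z : X) (A : set X) :
  is_preuniformity mu -> pretop_closed (preunif_pretop mu) A -> ~ A z ->
  exists V O, [/\ preunif_pretop mu V, preunif_pretop mu O,
    V `&` O = set0, V z & A `<=` O].
Proof.
move=> hmu clA nAz.
have [U muU UA] := clA z nAz.
have [V [W [muV muW VWU]]] := preunif_comp hmu muU.
exists (preunif_interior X mu (xsection V z)).
exists (preunif_interior X mu (\bigcup_(a in A) xsection (W^-1)%relation a)).
split; [exact: preunif_interior_open | exact: preunif_interior_open | | |].
- rewrite -subset0 => y [] /(preunif_interior_sub _ _ _ hmu) Vzy.
  case/(preunif_interior_sub _ _ _ hmu) => a Aa.
  rewrite /xsection /= in_setE => Wya.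
  move: Vzy; rewrite /xsection /= in_setE => Vzy.
  apply: (UA a) => //; rewrite /xsection /= in_setE.
  by apply: VWU; exists y.
- by exists V.
- move=> a Aa; exists (W^-1)%relation; first exact: (preunif_inv hmu).
  by move=> t Wat; exists a.
Qed.

Theorem proposition3p12 (X : Type) (X_nonempty : [set: X] !=set0)
    (mu : set (set (X * X))) (mu_preunif : is_preuniformity mu) :
  is_pretopology (preunif_pretop mu) /\ pretop_regular (preunif_pretop mu).
Proof.
split; first exact: preunif_pretop_pretopology.
split; first exact: preunif_pretop_T1.
by move=> z A; apply: preunif_pretop_separation.
Qed.
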